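(* Let $q>2$ be a prime power, $r\ge4$, and let $S\subseteq\mathrm{PG}(r,q)$ be a set of $q^{r-1}+q^{r-2}+t$ points, where $2q^{r-3}<t\le q^{r-2}+q-1$, such that every hyperplane meets $S$ in $0$, $q^{r-2}+2q^{r-3}$ or $q^{r-2}+t$ points. Then: (i) if $\pi$ is a $k$-dimensional subspace with $2\le k<r$, then $\pi\cap S=\emptyset$ or $|\pi\cap S|\ge q^{k-1}+2q^{k-2}$; (ii) no line meets $S$ in exactly one point; (iii) for every $k\in\{2,\ldots,r-1\}$ there exists at least one $k$-dimensional subspace meeting $S$ in exactly $q^{k-1}+2q^{k-2}$ points, and there exists at least one line meeting $S$ in exactly $2$ points; (iv) every plane meeting $S$ in exactly $q+2$ points meets it in a hyperoval; (v) $q$ is even; (vi) every hyperplane through an $(r-2)$-dimensional subspace meeting $S$ in exactly $q^{r-3}+2q^{r-4}$ points meets $S$ in exactly $q^{r-2}+2q^{r-3}$ points; (vii) $t=q^{r-2}$; (viii) for every $i\in\{1,\ldots,r-2\}$, every $(r-i+1)$-dimensional subspace through a fixed $(r-i)$-dimensional subspace meeting $S$ in exactly $q^{r-i-1}+2q^{r-i-2}$ points meets $S$ in exactly $q^{r-i}+2q^{r-i-1}$ points.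
   Context: A hyperoval of a projective plane $\mathrm{PG}(2,q)$ is a set of $q+2$ points no three collinear. *)

(* Defs.v *)
From HB Require Import structures.
From mathcomp Require Import all_boot all_algebra.

Set Implicit Arguments.
Unset Strict Implicit.
Unset Printing Implicit Defensive.

Import GRing.Theory VectorInternalTheory.

(* A subspace is stored as a canonical matrix over F, so there are finitely
   many of them when F is finite. *)
Section FiniteSubspaces.
Variables (F : finFieldType) (vT : vectType F).
HB.instance Definition _ := [Countable of {vspace vT} by <:].
HB.instance Definition _ := [Finite of {vspace vT} by <:].
End FiniteSubspaces.

Section ProjectiveSpace.
Variables (F : finFieldType) (r : nat).

Definition PGspace := {vspace 'rV[F]_r.+1}.

(* k is the projective dimension: vector-space dimension minus one. *)
Definition has_pdim (k : nat) (U : PGspace) : bool := \dim U == k.+1.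

Definition PG : Type := {P : PGspace | has_pdim 0 P}.
HB.instance Definition _ := SubFinite.on PG.

Definition incident (P : PG) (U : PGspace) : bool := (val P <= U)%VS.

Definition section (U : PGspace) (S : {set PG}) : {set PG} :=
  [set P in S | incident P U].

Definition is_line (U : PGspace) : bool := has_pdim 1 U.
Definition is_plane (U : PGspace) : bool := has_pdim 2 U.
Definition is_hyperplane (U : PGspace) : bool := has_pdim r.-1 U.

Definition collinear (P Q R : PG) : Prop :=
  exists L : PGspace,
    [/\ is_line L, incident P L, incident Q L & incident R L].

Definition is_hyperoval (U : PGspace) (H : {set PG}) : Prop :=
  [/\ is_plane U,
      (forall P, P \in H -> incident P U),
      #|H| = #|F| + 2 &
      forall P Q R, P \in H -> Q \in H -> R \in H ->
        P != Q -> P != R -> Q != R -> ~ collinear P Q R].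

End ProjectiveSpace.

(* Main.v *)
(* For a space U inside W, summing the section sizes of the spaces U + <v>
   over the vectors v of W outside U expresses their average in terms of
   |U n S| and |W n S|.  With W the whole space this yields, going down from
   hyperplanes, that a nonempty k-space has at least
   g_k = q^(k-1) + 2 q^(k-2) points, since the possible defect is less than 1.
   Conversely, if W has at most g_m + e points while all its nonempty j-spaces
   have at least g_j + e, the same bound survives down to the points, which
   forces e < 1; this produces spaces with exactly g_k points.  Around such a
   space the average is attained, so all spaces one dimension higher through it
   are minimal too, which gives t = q^(r-2). *)
Require Import Defs.
From HB Require Import structures.
From mathcomp Require Import all_boot all_algebra finfield.
From mathcomp Require Import zify.

Set Implicit Arguments.
Unset Strict Implicit.
Unset Printing Implicit Defensive.

Import GRing.Theory.

(** Without the rearrangement, [(X - 1) z <= (X - q) x + (q - 1) w] becomes [(X - q) G + (X - 1) D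
    <= (X - q) x + (q - 1) E]. It is meant for [X = q ^ p] and section sizes [x], [z], [w] of U, T,
    W, where [G] is the profile value for U and [D], [E] are the excesses of T and W. *)
Lemma average_lower_bound q X G D E x w z : 0 < q -> 0 < X ->
  X * z + q * x + w <= X * x + q * w + z -> w <= X * G + E ->
  q * G + D <= z ->
  X * G + X * D + q * x + E <= X * x + q * G + q * E + D.
Proof.
case: q => // k _; case: X => // l _ sum_le w_le z_ge.
have : l * (k.+1 * G + D) <= l * z by rewrite leq_mul2l z_ge orbT.
have : k * w <= k * (l.+1 * G + E) by rewrite leq_mul2l w_le orbT.
nia.
Qed.

(** * Subspaces, points and vector counts over a finite field *)

Section VectorCounting.
Variables (F : finFieldType) (r : nat).
Local Notation q := #|F|.
Local Notation space := (PGspace F r).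
Implicit Types (U W T H : space) (P Q : PG F r) (u v : 'rV[F]_r.+1).

Lemma card_PGspace W : #|W| = q ^ \dim W.
Proof. exact: card_vspace. Qed.

Lemma mem_addv_line_exchange U u v : u \notin U ->
  u \in (U + <[v]>)%VS -> v \in (U + <[u]>)%VS.
Proof.
move=> uU /memv_addP[w wU [_ /vlineP[k ->] def_u]].
have k0 : k != 0%R.
  by apply: contraNneq uU => k0; rewrite def_u k0 scale0r addr0.
have -> : v = (- (k^-1 *: w) + k^-1 *: u)%R.
  by rewrite def_u scalerDr scalerA mulVf // scale1r addKr.
by rewrite memv_add ?memvN ?memvZ ?memv_line.
Qed.

Lemma dim_addv_line U v : v \notin U -> \dim (U + <[v]>)%VS = (\dim U).+1.
Proof.
move=> vU; have v0 : v != 0%R by apply: contraNneq vU => ->; rewrite mem0v.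
rewrite dimv_disjoint_sum ?dim_vline ?v0 ?addn1 //.
apply/eqP; rewrite -subv0; apply/subvP => w /memv_capP[wU /vlineP[k def_w]].
have [k0|k0] := eqVneq k 0%R; first by rewrite def_w k0 scale0r mem0v.
case/negP: vU; have -> : v = (k^-1 *: w)%R by rewrite def_w scalerK.
exact: memvZ.
Qed.

Lemma addv_line_sub U W v : (U <= W)%VS -> v \in W -> (U + <[v]> <= W)%VS.
Proof. by move=> UW vW; rewrite subv_add UW -memvE. Qed.

Lemma addv_line_eq U T v : (U <= T)%VS -> \dim T = (\dim U).+1 ->
  v \in T -> v \notin U -> (U + <[v]>)%VS = T.
Proof.
move=> UT dT vT vU; apply/eqP.
by rewrite eqEdim addv_line_sub // dim_addv_line // dT leqnn.
Qed.

Lemma exists_intermediate_space U W d : (U <= W)%VS ->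
  \dim U <= d <= \dim W -> exists T, [/\ (U <= T)%VS, (T <= W)%VS & \dim T = d].
Proof.
move=> UW; elim: d => [|d IHd] /andP[Ud dW].
  by exists U; split=> //; lia.
have [eqd|ltd] := eqVneq (\dim U) d.+1; first by exists U; split.
have [|T [UT TW dT]] := IHd; first by lia.
have /subvPn[v vW vT] : ~~ (W <= T)%VS.
  by apply: contraL dW => /dimvS; rewrite dT -ltnNge ltnS.
exists (T + <[v]>)%VS; split; last by rewrite dim_addv_line // dT.
- exact: subv_trans UT (addvSl _ _).
- exact: addv_line_sub.
Qed.

Lemma pointP P : exists2 v, v != 0%R & val P = <[v]>%VS.
Proof.
have dP : \dim (val P) = 1 by apply/eqP; exact: valP P.
exists (vpick (val P)).
  by rewrite vpick0 -dimv_eq0 dP.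
apply/eqP; rewrite eq_sym eqEdim -memvE memv_pick dP dim_vline vpick0.
by rewrite -dimv_eq0 dP.
Qed.

Lemma dim_point P : \dim (val P) = 1.
Proof. by apply/eqP; exact: valP P. Qed.

Lemma point_le_eq P Q : (val P <= val Q)%VS -> P = Q.
Proof.
by move=> PQ; apply/val_inj/eqP; rewrite eqEdim !dim_point andbT.
Qed.

Lemma dim_add_points P Q : P != Q -> \dim (val P + val Q)%VS = 2.
Proof.
move=> PQ; have [v _ def_Q] := pointP Q.
rewrite def_Q dim_addv_line ?dim_point //.
by rewrite memvE -def_Q; apply: contra PQ => /point_le_eq->.
Qed.

Lemma card_setD_space U W : (U <= W)%VS ->
  #|[pred v | (v \in W) && (v \notin U)]| = q ^ \dim W - q ^ \dim U.
Proof.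
move=> UW; rewrite -!card_PGspace -(cardID (mem U) (mem W)).
rewrite [X in _ = X + _ - _](_ : _ = #|U|); last first.
  by apply: eq_card => v; rewrite !inE andb_idl // => /(subvP UW).
by rewrite addKn; apply: eq_card => v; rewrite !inE andbC.
Qed.

(** * Averaging section sizes over the spaces one dimension above U *)

Variable S : {set PG F r}.
Local Notation sec U := #|section U S|.

Lemma sec_le U W : (U <= W)%VS -> sec U <= sec W.
Proof.
move=> UW; apply/subset_leq_card/subsetP => P; rewrite !inE => /andP[-> PU].
exact: subv_trans PU UW.
Qed.

(* Counting vectors v outside U instead of the subspaces U + <v> avoids
   enumerating subspaces: each U + <v> is hit by q^(d+1) - q^d vectors. *)
Lemma sum_section_addv_line U W : (U <= W)%VS ->
  \sum_(v | (v \in W) && (v \notin U)) sec (U + <[v]>)%VS =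
  (q ^ \dim W - q ^ \dim U) * sec U +
  (q ^ (\dim U).+1 - q ^ \dim U) * (sec W - sec U).
Proof.
move=> UW.
transitivity (\sum_(v | (v \in W) && (v \notin U))
  \sum_(P in S) (incident P (U + <[v]>)%VS : nat)).
  apply: eq_bigr => v _; rewrite -sum1_card big_mkcond [RHS]big_mkcond.
  by apply: eq_bigr => P _; rewrite inE; case: (P \in S); case: incident.
rewrite exchange_big /=.
(* After the swap each point P = <p> counts the vectors v with P in U + <v>: all of them if P lies
   in U, those of U + <p> outside U if P lies in W only (exchange property), none otherwise. *)
transitivity (\sum_(P in S) ((q ^ \dim W - q ^ \dim U) * incident P U +
   (q ^ (\dim U).+1 - q ^ \dim U) * (incident P W && ~~ incident P U))).
  apply: eq_bigr => P PS.
  transitivity #|[pred v | (v \in W) && (v \notin U) &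
                   incident P (U + <[v]>)%VS]|.
    rewrite -sum1_card [LHS]big_mkcond [RHS]big_mkcond; apply: eq_bigr => v _.
    by rewrite !inE; case: (_ \in W); case: (_ \in U); case: incident.
  have [PU|PU] := boolP (incident P U).
    rewrite andbF muln0 addn0 muln1 -card_setD_space //.
    apply: eq_card => v; rewrite !inE andb_idr // => _.
    exact: subv_trans PU (addvSl _ _).
  have [p p0 def_P] := pointP P.
  have pU : p \notin U by rewrite memvE -def_P.
  rewrite muln0 add0n andbT; have [PW|PW] := boolP (incident P W); last first.
    rewrite muln0; apply: eq_card0 => v; rewrite !inE; apply/negP.
    case/andP=> /andP[vW _] Pv; case/negP: PW.
    exact: subv_trans Pv (addv_line_sub UW vW).
  rewrite muln1 -(dim_addv_line pU) -card_setD_space ?addvSl //.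
  have pW : p \in W by rewrite memvE -def_P.
  apply: eq_card => v; rewrite !inE /incident def_P -memvE.
  apply/idP/idP.
    by case/andP=> /andP[_ vU] pv; rewrite vU (mem_addv_line_exchange pU).
  case/andP=> vp vU; rewrite vU (mem_addv_line_exchange vU vp) !andbT.
  exact: (subvP (addv_line_sub UW pW)).
rewrite big_split /= -!big_distrr /=; congr (_ * _ + _ * _).
  rewrite -sum1_card big_mkcond [RHS]big_mkcond; apply: eq_bigr => P _.
  by rewrite inE; case: (P \in S); case: incident.
have -> : sec U = #|section W S :&: section U S|.
  apply: eq_card => P; rewrite !inE; case: (P \in S) => //=.
  by rewrite andb_idl // => PU; exact: subv_trans PU UW.
rewrite -cardsD -sum1_card big_mkcond [RHS]big_mkcond; apply: eq_bigr => P _.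
by rewrite !inE; case: (P \in S); case: incident; case: incident.
Qed.

(* This is (q^p - q) c + (q - 1) |H n S| <= (q^p - q) |U n S| + (q - 1) |W n S|,
   with terms moved so that no truncated subtraction occurs. *)
Lemma section_sum_split U W H c p : (U <= H)%VS -> (H <= W)%VS ->
    \dim H = (\dim U).+1 -> \dim W = \dim U + p ->
    (forall T, (U <= T)%VS -> (T <= W)%VS -> \dim T = (\dim U).+1 ->
       c <= sec T) ->
  q ^ p * c + q * sec H + q * sec U + sec W <=
  q ^ p * sec U + q * sec W + q * c + sec H.
Proof.
move=> UH HW dH dW minc; have UW := subv_trans UH HW.
have q_gt0 : 0 < q by apply/card_gt0P; exists 0%R.
have p_gt0 : 0 < p by have := dimvS HW; lia.
have := sum_section_addv_line UW.
(* Vectors of H outside U all span H with U; every other vector gives a space with at least [c]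
   points. *)
rewrite (bigID (mem H)) /= dW expnD expnSr.
set s1 := (\sum_(v | _ && (_ \in H)) _)%N.
set s2 := (\sum_(v | _ && (_ \notin H)) _)%N.
have -> : s1 = (q ^ \dim U * q - q ^ \dim U) * sec H.
  transitivity (\sum_(v | (v \in H) && (v \notin U)) sec H)%N.
    apply: eq_big => [v|v /andP[/andP[vW vU] vH]].
      rewrite andbAC; case: (boolP (v \in H)) => [vH|]; last by rewrite andbF.
      by rewrite (subvP HW).
    by rewrite (addv_line_eq UH dH vH vU).
  by rewrite sum_nat_const card_setD_space // dH expnSr.
have : (q ^ \dim U * q ^ p - q ^ \dim U * q) * c <= s2.
  have <- : (\sum_(v | (v \in W) && (v \notin H)) c)%N =
            ((q ^ \dim U * q ^ p - q ^ \dim U * q) * c)%N.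
    by rewrite sum_nat_const card_setD_space // dH dW expnD expnSr.
  rewrite /s2 big_mkcond [leqRHS]big_mkcond; apply: leq_sum => v _.
  have [vW|//] := boolP (v \in W); have [|vH] /= := boolP (v \in H).
    by rewrite andbF.
  have vU : v \notin U by apply: contra vH => /(subvP UH).
  by rewrite vU minc ?addvSl ?addv_line_sub ?dim_addv_line.
have le_UW := sec_le UW.
have : q <= q ^ p by rewrite -[leqLHS]expn1 leq_pexp2l.
have : 0 < q ^ \dim U by rewrite expn_gt0 q_gt0.
move: (q ^ \dim U) (q ^ p) => Q X Q_gt0 qX le_s2 sumE.
rewrite -(leq_pmul2l Q_gt0).
case: (q) q_gt0 qX le_s2 sumE => // k _ /subnKC <-; move: (X - k.+1) => l.
move: le_UW => /subnKC <-; move: (sec W - sec U) => y.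
clearbody s2; move: (sec U) (sec H) => x h.
rewrite -!mulnBr !addKn !addSn !mulnS !addKn; nia.
Qed.

(** When all terms are equal the average is exact: [(q^p - 1) c = (q^p - q) |U n S| + (q - 1) |W n
    S|], again without subtraction. *)
Lemma section_sum_const U W c p : (U <= W)%VS -> \dim W = \dim U + p ->
    (forall T, (U <= T)%VS -> (T <= W)%VS -> \dim T = (\dim U).+1 ->
       sec T = c) ->
  q ^ p * c + q * sec U + sec W = q ^ p * sec U + q * sec W + c.
Proof.
move=> UW dW eqc; have q_gt0 : 0 < q by apply/card_gt0P; exists 0%R.
have := sum_section_addv_line UW.
rewrite (eq_bigr (fun=> c)); last first.
  by move=> v /andP[vW vU]; rewrite eqc ?addvSl ?addv_line_sub ?dim_addv_line.
rewrite sum_nat_const card_setD_space // dW expnD expnSr.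
have le_UW := sec_le UW.
have : 0 < q ^ p by rewrite expn_gt0 q_gt0.
have : 0 < q ^ \dim U by rewrite expn_gt0 q_gt0.
move: (q ^ \dim U) (q ^ p) => Q X Q_gt0 X_gt0 sumE.
apply/eqP; rewrite -(eqn_pmul2l Q_gt0); apply/eqP.
case: (q) q_gt0 sumE => // k _; case: X X_gt0 => // l _.
move: le_UW => /subnKC <-; move: (sec W - sec U) => y.
rewrite !addKn !mulnS !addKn; nia.
Qed.

(** A smallest section T does it: [section_sum_split] applies with T as the distinguished space and
    [sec T] as the lower bound. *)
Lemma exists_section_le_average U W p : (U <= W)%VS ->
    \dim W = \dim U + p.+1 ->
  exists T, [/\ (U <= T)%VS, (T <= W)%VS, \dim T = (\dim U).+1 &
    q ^ p.+1 * sec T + q * sec U + sec W <=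
    q ^ p.+1 * sec U + q * sec W + sec T].
Proof.
move=> UW dW.
have [|H [UH HW dH]] := @exists_intermediate_space U W (\dim U).+1 UW.
  by lia.
pose between T := [&& (U <= T)%VS, (T <= W)%VS & \dim T == (\dim U).+1].
have bH : between H by rewrite /between UH HW dH eqxx.
case: (arg_minnP (fun T => sec T) bH) => T /and3P[UT TW /eqP dT] minT.
exists T; split=> //.
have := section_sum_split UT TW dT dW (c := sec T).
rewrite -addnA => sumT; suff /sumT : forall T', (U <= T')%VS -> (T' <= W)%VS ->
  \dim T' = (\dim U).+1 -> sec T <= sec T' by lia.
by move=> T' UT' T'W dT'; apply: minT; rewrite /between UT' T'W dT' eqxx.
Qed.

Lemma section_point P : P \in S -> sec (val P) = 1.
Proof.
move=> PS; rewrite (_ : section _ _ = [set P]) ?cards1 //.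
apply/setP => Q; rewrite !inE; apply/andP/eqP => [[_ QP]|->]; last first.
  by rewrite PS /incident subvv.
exact: point_le_eq.
Qed.

(* The excess e over the profile q^(j-1) + 2 q^(j-2) cannot decrease when
   passing from nonempty (j+1)-spaces of W to nonempty j-spaces, and no excess
   is possible for points.  Everything is scaled by q^2 so that the profile
   makes sense down to j = 0. *)
Lemma no_uniform_excess W m j e : 0 < e -> j < m -> \dim W = m.+1 ->
    0 < sec W -> q ^ 2 * sec W <= q ^ m * (q + 2) + q ^ 2 * e ->
    (forall U, (U <= W)%VS -> \dim U = j.+1 -> 0 < sec U ->
       q ^ j * (q + 2) + q ^ 2 * e <= q ^ 2 * sec U) -> False.
Proof.
move=> e_gt0 jm dW W_gt0 W_le.
have q_gt0 : 0 < q by apply/card_gt0P; exists 0%R.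
elim: j jm => [|j IHj] jm minj.
  have [P] := card_gt0P W_gt0; rewrite inE => /andP[PS PW].
  have := minj _ PW (dim_point P); rewrite section_point // => /(_ isT).
  by rewrite expn0; nia.
apply: IHj => [|U UW dU U_gt0]; first exact: ltnW.
have [p def_p] : exists p, m = j + p.+2 by exists (m - j - 2); lia.
have dW' : \dim W = \dim U + p.+2 by rewrite dW dU def_p; lia.
have [T [UT TW dT sumT]] := exists_section_le_average UW dW'.
have T_gt0 : 0 < sec T := leq_trans U_gt0 (sec_le UT).
have := minj T TW; rewrite dT dU => /(_ erefl T_gt0).
move=> T_ge; have q_gt1 : 1 < q := finNzRing_gt1 F.
have W_le' : q ^ 2 * sec W <= q ^ p.+2 * (q ^ j * (q + 2)) + q ^ 2 * e.
  by apply: leq_trans W_le _; rewrite def_p expnD mulnCA mulnA.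
have T_ge' : q * (q ^ j * (q + 2)) + q ^ 2 * e <= q ^ 2 * sec T.
  by rewrite mulnA -expnS.
have sumT' : q ^ p.+2 * (q ^ 2 * sec T) + q * (q ^ 2 * sec U) + q ^ 2 * sec W
   <= q ^ p.+2 * (q ^ 2 * sec U) + q * (q ^ 2 * sec W) + q ^ 2 * sec T.
  by rewrite !(mulnCA _ (q ^ 2)) -!mulnDr leq_mul2l sumT orbT.
have X_gt : q < q ^ p.+2 by rewrite -[ltnLHS]expn1 ltn_exp2l.
(* Here [D = E = q ^ 2 * e], so the excess terms combine to [(X - q) q^2 e] with [X = q ^ p.+2], and
   the positive factor [X - q] cancels. *)
have := average_lower_bound q_gt0 (ltn_trans q_gt0 X_gt) sumT' W_le' T_ge'.
case: (q ^ p.+2) X_gt => // l; rewrite ltnS => /subnKC <-; move: (l - q) => i.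
by rewrite -(@leq_pmul2l i.+1) //; nia.
Qed.

End VectorCounting.

(** * Lower bounds for nonempty sections, with r = n + 4 *)

Section ThreeIntersectionNumbers.
Variables (F : finFieldType) (n t : nat) (S : {set PG F n.+4}).
Local Notation q := #|F|.
Local Notation space := (PGspace F n.+4).
Local Notation sec U := #|section U S|.
Implicit Types (U W T H L : space) (P Q : PG F n.+4).

Hypothesis q_gt2 : 2 < q.
Hypothesis t_gt : 2 * q ^ n.+1 < t.
Hypothesis t_lt : t < q ^ n.+2 + q.
Hypothesis card_S : #|S| = q ^ n.+3 + q ^ n.+2 + t.
Hypothesis hyperplane_section : forall H, \dim H = n.+4 ->
  [\/ sec H = 0, sec H = q ^ n.+2 + 2 * q ^ n.+1 | sec H = q ^ n.+2 + t].

Let q_gt0 : 0 < q. Proof. by lia. Qed.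

Lemma sec_fullv : sec (fullv : space) = q ^ n.+3 + q ^ n.+2 + t.
Proof.
rewrite -card_S; congr #|pred_of_set _|; apply/setP => P.
by rewrite inE /incident subvf andbT.
Qed.

Lemma dim_full : \dim (fullv : space) = n.+4.+1.
Proof. by rewrite dimvf /dim /= mul1n. Qed.

(** Downward induction from hyperplanes, where [t_gt] gives the bound; U has projective dimension k
    + 2. The upper bound on [t] leaves the whole space an excess of at most q - 1. *)
Lemma nonempty_section_ge U k : k <= n.+1 -> \dim U = k.+3 -> 0 < sec U ->
  q ^ k.+1 + 2 * q ^ k <= sec U.
Proof.
move=> /subnKC; move: (n.+1 - k) => p.
elim: p k U => [|p IHp] k U def_n dU U_gt0.
  have def_k : k = n.+1 by lia.
  move: dU t_gt; rewrite def_k => dU t_gt'.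
  by have [] := hyperplane_section dU; lia.
have dF : \dim (fullv : space) = \dim U + p.+2 by rewrite dim_full dU; lia.
have [T [UT _ dT sumT]] := exists_section_le_average S (subvf U) dF.
have T_gt0 : 0 < sec T := leq_trans U_gt0 (sec_le S UT).
have T_ge : q * (q ^ k * (q + 2)) + 0 <= sec T.
  have := IHp k.+1 T; rewrite dT dU => /(_ _ erefl T_gt0) IH.
  by apply: leq_trans (IH _); [rewrite !expnS; lia | lia].
have W_le : sec (fullv : space) <= q ^ p.+2 * (q ^ k * (q + 2)) + q.-1.
  rewrite sec_fullv; move: t_lt; have -> : n.+3 = (k + p.+2).+1 by lia.
  have -> : n.+2 = k + p.+2 by lia.
  by rewrite expnS expnD; nia.
have X_gt0 : 0 < q ^ p.+2 by rewrite expn_gt0 q_gt0.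
have := average_lower_bound q_gt0 X_gt0 sumT W_le T_ge.
have : q * q <= q ^ p.+2 by rewrite mulnn leq_pexp2l.
(* A deficit of at least 1 would force [X - q <= (q - 1)^2], whereas [X >= q^2] gives
   [X - q >= q (q - 1)]. *)
move=> X_ge sum_le; rewrite leqNgt; apply/negP => x_lt.
move: x_lt sum_le X_ge; rewrite expnS.
have -> : q * q ^ k + 2 * q ^ k = q ^ k * (q + 2) by lia.
move: (q ^ k * _) (q ^ p.+2) (sec U) => G X x.
case: (q) q_gt2 => // i i_gt /= x_lt sum_le X_ge.
have [m def_X] : exists m, X = i.+1 + m by exists (X - i.+1); nia.
have : m * x.+1 <= m * G by rewrite leq_mul2l x_lt orbT.
by rewrite def_X in sum_le X_ge; nia.
Qed.

(** Every plane through a tangent line would have at least q + 2 points, but their average, computed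
    from |S|, is smaller. *)
Lemma line_section_neq1 L : \dim L = 2 -> sec L <> 1.
Proof.
move=> dL L1.
have dF : \dim (fullv : space) = \dim L + n.+3 by rewrite dim_full dL; lia.
have [T [LT _ dT sumT]] := exists_section_le_average S (subvf L) dF.
have : q ^ 1 + 2 * q ^ 0 <= sec T.
  by apply: nonempty_section_ge => //; rewrite ?dT ?dL // -L1 sec_le.
have : q * q <= q ^ n.+2 by rewrite mulnn leq_pexp2l.
move: sumT; rewrite sec_fullv L1 expn1 expn0 [q ^ n.+3]expnS.
move: t_lt; move: (q ^ n.+2) (sec T) => Y z.
case: (q) q_gt0 => // i _ t_le sum_le Y_ge z_ge.
have : (i.+1 * Y).-1 * (i.+1 + 2) <= (i.+1 * Y).-1 * z.
  by rewrite leq_mul2l orbC; lia.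
have : i * t <= i * (Y + i) by rewrite leq_mul2l orbC; lia.
by nia.
Qed.

(** * Existence of minimal sections *)

(** Otherwise every nonempty hyperplane section has excess [t - 2 * q ^ n.+1], and averaging shows
    that nonempty spaces of codimension 2 have at least this excess, against [no_uniform_excess]. *)
Lemma exists_hyperplane_min :
  exists2 H, \dim H = n.+4 & sec H = q ^ n.+2 + 2 * q ^ n.+1.
Proof.
have [/existsP[H /andP[/eqP dH /eqP sH]]|noH] := boolP [exists H : space,
    (\dim H == n.+4) && (sec H == q ^ n.+2 + 2 * q ^ n.+1)].
  by exists H.
have large H : \dim H = n.+4 -> 0 < sec H -> sec H = q ^ n.+2 + t.
  move=> dH H_gt0; have [H0|Ha|//] := hyperplane_section dH.
    by rewrite H0 in H_gt0.
  by case/existsP: noH; exists H; rewrite dH Ha !eqxx.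
have [P PS] : exists P, P \in S by apply/card_gt0P; rewrite card_S; lia.
have [||W [PW _ dW]] := @exists_intermediate_space F n.+4 (val P) fullv n.+4.
- exact: subvf.
- by rewrite dim_point dim_full ltnS leqnSn.
have W_gt0 : 0 < sec W by rewrite -(section_point PS) sec_le.
have e_gt0 : 0 < t - 2 * q ^ n.+1 by lia.
case: (no_uniform_excess e_gt0 (ltnSn n.+2) dW W_gt0) => [|U UW dU U_gt0].
  rewrite large // -{1}(subnKC (ltnW t_gt)); move: (t - _) => e.
  by rewrite !expnS expn0; nia.
have dF : \dim (fullv : space) = \dim U + 2 by rewrite dim_full dU; lia.
have [T [UT _ dT sumT]] := exists_section_le_average S (subvf U) dF.
have T_gt0 : 0 < sec T := leq_trans U_gt0 (sec_le S UT).
rewrite dU in dT; rewrite sec_fullv large // in sumT.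
(* In codimension 2 the average reads [(q + 1) |T n S| <= q |U n S| + |S|], with
   [|T n S| = q^(n+2) + t]. *)
have x_ge : t <= sec U.
  move: sumT; rewrite [q ^ n.+3]expnS expnS expn1.
  move: (q ^ n.+2) (sec U) => Y x; case: (q) q_gt2 => // i i_gt1 sumT.
  by rewrite -(@leq_pmul2l (i * i.+1)) //; nia.
have : q ^ 2 * t <= q ^ 2 * sec U by rewrite leq_mul2l x_ge orbT.
apply: leq_trans; rewrite -{2}(subnKC (ltnW t_gt)); move: (t - _) => e.
by rewrite !expnS expn0; move: (q ^ n) => Y; nia.
Qed.

(** If no space of this dimension were minimal, integrality would give all nonempty ones an excess
    of at least 1 inside a minimal hyperplane. *)
Lemma exists_section_min k : k <= n.+1 ->
  exists2 U, \dim U = k.+3 & sec U = q ^ k.+1 + 2 * q ^ k.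
Proof.
have [W dW sW] := exists_hyperplane_min.
rewrite leq_eqVlt => /predU1P[->|k_le]; first by exists W.
have [/existsP[H /andP[/eqP dH /eqP sH]]|noU] := boolP [exists U : space,
    (\dim U == k.+3) && (sec U == q ^ k.+1 + 2 * q ^ k)].
  by exists H.
have W_gt0 : 0 < sec W by rewrite sW addn_gt0 expn_gt0 q_gt0.
case: (@no_uniform_excess _ _ S W n.+3 k.+2 1) => // [|U UW dU U_gt0].
  by rewrite sW !expnS; nia.
have := nonempty_section_ge (ltnW k_le) dU U_gt0.
rewrite leq_eqVlt => /predU1P[eqU|].
  by case/existsP: noU; exists U; rewrite dU eqU !eqxx.
by rewrite !expnS expn0; move: (q ^ k) (sec U) => Y x; nia.
Qed.

(** * Planes with q + 2 points: hyperovals and the parity of q *)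

(** Each of the q + 1 lines of U through a point of the section carries a further point, and only q
    + 1 further points exist. *)
Lemma oval_plane_line_le2 U L : \dim U = 3 -> sec U = q + 2 ->
  (L <= U)%VS -> \dim L = 2 -> sec L <= 2.
Proof.
move=> dU sU LU dL; have [->//|] := posnP (sec L).
case/card_gt0P => P; rewrite inE => /andP[PS PL].
have dP : \dim U = \dim (val P) + 2 by rewrite dU dim_point.
have := section_sum_split (S := S) (c := 2) PL LU _ dP.
rewrite (dim_point P) section_point // sU => /(_ dL) sumL.
have {sumL} /sumL : forall T, (val P <= T)%VS -> (T <= U)%VS -> \dim T = 2 ->
    1 < sec T.
  move=> T PT _ dT; have := sec_le S PT; rewrite section_point // leq_eqVlt.
  by case/predU1P => // T1; case: (line_section_neq1 dT).
by rewrite expnS expn1; case: (q) q_gt2 => // i i_gt; nia.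
Qed.

Lemma oval_plane_hyperoval U : \dim U = 3 -> sec U = q + 2 ->
  is_hyperoval U (section U S).
Proof.
move=> dU sU; split=> [|P|//|P Q R PS QS RS PQ PR QR].
- by rewrite /is_plane /has_pdim dU.
- by rewrite inE => /andP[].
case=> L [/eqP dL PL QL RL].
have LU : (L <= U)%VS.
  have <- : (val P + val Q)%VS = L.
    apply/eqP; rewrite eqEdim subv_add dL (dim_add_points PQ) andbT.
    by apply/andP; split; [exact: PL | exact: QL].
  move: PS QS; rewrite !inE subv_add => /andP[_ PU] /andP[_ QU].
  by apply/andP; split.
have := oval_plane_line_le2 dU sU LU dL; rewrite leqNgt => /negP[].
have onL X : X \in section U S -> incident X L -> X \in section L S.
  by rewrite !inE => /andP[-> _].
have RP : R != P by rewrite eq_sym; exact: PR.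
apply/card_gt2P; exists P, Q, R; split; last exact: (And3 PQ QR RP).
exact: (And3 (onL P PS PL) (onL Q QS QL) (onL R RS RL)).
Qed.

(* A point u + v of the plane, with u and v on the hyperoval, is off the
   hyperoval, and the lines through it cut the q + 2 points into pairs. *)
Lemma even_q : ~~ odd q.
Proof.
have [U dU] := @exists_section_min 0 isT; rewrite expn1 expn0 => sU.
have [_ _ _ arc] := oval_plane_hyperoval dU sU.
have /card_gt1P[P1 [P2 [P1U P2U P12]]] : 1 < sec U by rewrite sU; lia.
have [u u0 def_P1] := pointP P1; have [v v0 def_P2] := pointP P2.
have vu : v \notin <[u]>%VS.
  rewrite -def_P1 memvE -def_P2.
  by apply: contra P12 => /point_le_eq->.
have uv : u \notin <[v]>%VS.
  rewrite -def_P2 memvE -def_P1.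
  by apply: contra P12 => /point_le_eq->.
have w0 : (u + v)%R != 0%R.
  apply: contra vu; rewrite addrC addr_eq0 => /eqP->.
  by rewrite memvN memv_line.
have dQ : has_pdim 0 (<[u + v]>%VS : space) by rewrite /has_pdim dim_vline w0.
pose Q : PG F n.+4 := exist (has_pdim 0) _ dQ.
have QL : (<[u + v]> <= val P1 + val P2)%VS.
  by rewrite -memvE def_P1 def_P2 memv_add ?memv_line.
have QU : (val Q <= U)%VS.
  apply: subv_trans QL _; rewrite subv_add.
  by move: P1U P2U; rewrite !inE => /andP[_ P1U] /andP[_ P2U]; apply/andP.
have QS : Q \notin S.
  apply/negP => QS; apply: (arc P1 P2 Q P1U P2U _ P12).
  - by rewrite inE QS.
  - apply: contraNneq vu => eqQ.
    have := memv_line (u + v)%R; rewrite -[<[u + v]>%VS]/(val Q) -eqQ def_P1.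
    by rewrite rpredDl ?memv_line.
  - apply: contraNneq uv => eqQ.
    have := memv_line (u + v)%R; rewrite -[<[u + v]>%VS]/(val Q) -eqQ def_P2.
    by rewrite rpredDr ?memv_line.
  exists (val P1 + val P2)%VS; split; rewrite /incident ?addvSl ?addvSr //.
  by rewrite /is_line /has_pdim dim_add_points.
pose f P : space := (val P + val Q)%VS.
have df P : P \in S -> \dim (f P) = 2.
  by move=> PS; rewrite dim_add_points //; apply: contraNneq QS => <-.
have fU P : P \in section U S -> (f P <= U)%VS.
  by rewrite inE subv_add => /andP[_ PU]; apply/andP.
suff card_U : sec U = #|preim_partition f (section U S)| * 2.
  have : odd (sec U) = false by rewrite card_U muln2 odd_double.
  by rewrite sU oddD addbF => ->.
apply: card_uniform_partition (preim_partitionP _ _).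
move=> _ /imsetP[P PU ->].
have PS : P \in S by move: PU; rewrite inE => /andP[].
(* The block of P is the section of the line [f P]: a point R of S on that line spans the same line
   with Q, as Q is not in S. *)
transitivity (sec (f P)).
  apply: eq_card => R; rewrite !inE; case RS: (R \in S) => //=.
  apply/andP/idP => [[_ /eqP->]|RP]; first exact: addvSl.
  have RU : incident R U by apply: subv_trans RP (fU P PU).
  split=> //; rewrite eq_sym eqEdim !df // subv_add addvSr andbT andbT.
  exact: RP.
have := oval_plane_line_le2 dU sU (fU P PU) (df P PS).
have := line_section_neq1 (df P PS).
have : sec (val P) <= sec (f P) by rewrite sec_le ?addvSl.
by rewrite section_point //; case: (sec (f P)) => [|[|[|]]].
Qed.

(** * Spaces through a minimal section and the value of t *)

(** If H had [q ^ n.+2 + t] points, [t] would cancel against |S| in the sum over hyperplanes through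
    U, leaving [q^(n+2) <= 2 q^(n+1)], which [q_gt2] excludes. *)
Lemma hyperplane_over_min U H : \dim U = n.+3 ->
  sec U = q ^ n.+1 + 2 * q ^ n -> \dim H = n.+4 -> (U <= H)%VS ->
  sec H = q ^ n.+2 + 2 * q ^ n.+1.
Proof.
move=> dU sU dH UH.
have U_gt0 : 0 < sec U by rewrite sU addn_gt0 expn_gt0 q_gt0.
have H_gt0 := leq_trans U_gt0 (sec_le S UH).
have [H0|//|Hb] := hyperplane_section dH; first by rewrite H0 in H_gt0.
have dF : \dim (fullv : space) = \dim U + 2 by rewrite dim_full dU; lia.
have dH' : \dim H = (\dim U).+1 by rewrite dU.
have minT T : (U <= T)%VS -> (T <= fullv)%VS -> \dim T = (\dim U).+1 ->
    q ^ n.+2 + 2 * q ^ n.+1 <= sec T.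
  move=> UT _ dT; apply: nonempty_section_ge; rewrite ?dT ?dU //.
  exact: leq_trans U_gt0 (sec_le S UT).
have := section_sum_split UH (subvf H) dH' dF minT.
rewrite sec_fullv Hb sU !expnS; have : 0 < q ^ n by rewrite expn_gt0 q_gt0.
move: (q ^ n) => [//|Y] _; case: (q) q_gt2 => [|[|[|i]]] // _.
by rewrite expn0; nia.
Qed.

(** Around a minimal space U of codimension 2 all hyperplanes have the same size c, so
    [(q + 1) c = q |U n S| + |S|] determines |S|. *)
Lemma t_value : t = q ^ n.+2.
Proof.
have [U dU sU] := exists_section_min (leqnSn n).
have dF : \dim (fullv : space) = \dim U + 2 by rewrite dim_full dU; lia.
have eqT T : (U <= T)%VS -> (T <= fullv)%VS -> \dim T = (\dim U).+1 ->
    sec T = q ^ n.+2 + 2 * q ^ n.+1.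
  by move=> UT _ dT; apply: hyperplane_over_min sU _ UT; rewrite ?dT dU.
have := section_sum_const (subvf U) dF eqT.
rewrite sec_fullv sU !expnS expn0; move: (q ^ n) => Y.
case: (q) q_gt2 => // i i_gt sumE.
apply/eqP; rewrite -(@eqn_pmul2l i); last by lia.
by apply/eqP; nia.
Qed.

(** Once [t] is known, |S| itself fits the profile, so the average around U equals the lower bound
    of [nonempty_section_ge] and no space can exceed it. For [k = n.+1] W is the whole space. *)
Lemma section_over_min U W k : k <= n.+1 -> \dim U = k.+3 ->
  sec U = q ^ k.+1 + 2 * q ^ k -> \dim W = k.+4 -> (U <= W)%VS ->
  sec W = q ^ k.+2 + 2 * q ^ k.+1.
Proof.
rewrite leq_eqVlt => /predU1P[->|k_le] dU sU dW UW.
  have -> : W = fullv by apply/eqP; rewrite eqEdim subvf dW dim_full leqnn.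
  by rewrite sec_fullv t_value; lia.
have U_gt0 : 0 < sec U by rewrite sU addn_gt0 expn_gt0 q_gt0.
have minT T : (U <= T)%VS -> (T <= fullv)%VS -> \dim T = (\dim U).+1 ->
    q ^ k.+2 + 2 * q ^ k.+1 <= sec T.
  move=> UT _ dT; apply: nonempty_section_ge; rewrite ?dT ?dU //.
  exact: leq_trans U_gt0 (sec_le S UT).
have dF : \dim (fullv : space) = \dim U + (n.+2 - k).
  by rewrite dim_full dU; lia.
have dW' : \dim W = (\dim U).+1 by rewrite dU.
apply/eqP; rewrite eqn_leq minT ?subvf // andbT.
have := section_sum_split UW (subvf W) dW' dF minT.
have -> : sec (fullv : space) = q ^ (n.+2 - k) * (q ^ k * (q + 2)).
  rewrite mulnA -expnD subnK; last by lia.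
  by rewrite sec_fullv t_value expnS; lia.
rewrite sU !expnS; move: (q ^ k) (q ^ (n.+2 - k)) (sec W) => Y X h.
case: (q) q_gt2 => // i i_gt sum_le; rewrite -(@leq_pmul2l i); last by lia.
by nia.
Qed.

Lemma exists_secant_line : exists2 L, \dim L = 2 & sec L = 2.
Proof.
have [U dU] := @exists_section_min 0 isT; rewrite expn1 expn0 => sU.
have /card_gt1P[P [Q [PU QU PQ]]] : 1 < sec U by rewrite sU; lia.
have dL := dim_add_points PQ; exists (val P + val Q)%VS => //.
move: PU QU; rewrite !inE => /andP[PS PU] /andP[QS QU].
have LU : (val P + val Q <= U)%VS by rewrite subv_add; apply/andP.
apply/eqP; rewrite eqn_leq (oval_plane_line_le2 dU sU LU dL).
apply/card_gt1P; exists P, Q; split; last exact: PQ.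
- by rewrite inE PS /incident addvSl.
- by rewrite inE QS /incident addvSr.
Qed.

End ThreeIntersectionNumbers.

Theorem theorem5p3 (F : finFieldType) (q r t : nat) (S : {set PG F r})
    (hF : #|F| = q) (hq : 2 < q) (hr : 4 <= r)
    (ht1 : 2 * q ^ (r - 3) < t) (ht2 : t <= q ^ (r - 2) + q - 1)
    (hS : #|S| = q ^ (r - 1) + q ^ (r - 2) + t)
    (hH : forall H : PGspace F r, is_hyperplane H ->
       [\/ #|section H S| = 0,
           #|section H S| = q ^ (r - 2) + 2 * q ^ (r - 3) |
           #|section H S| = q ^ (r - 2) + t]) :
  (* (i) *)
  (forall (k : nat) (U : PGspace F r), 2 <= k -> k < r -> has_pdim k U ->
     section U S = set0 \/
     q ^ (k - 1) + 2 * q ^ (k - 2) <= #|section U S|) /\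
  (* (ii) *)
  (forall L : PGspace F r, is_line L -> #|section L S| <> 1) /\
  (* (iii) *)
  ((forall k : nat, 2 <= k -> k <= r - 1 ->
      exists U : PGspace F r, has_pdim k U /\
        #|section U S| = q ^ (k - 1) + 2 * q ^ (k - 2)) /\
   (exists L : PGspace F r, is_line L /\ #|section L S| = 2)) /\
  (* (iv) *)
  (forall U : PGspace F r, is_plane U -> #|section U S| = q + 2 ->
     is_hyperoval U (section U S)) /\
  (* (v) *)
  ~~ odd q /\
  (* (vi) *)
  (forall U H : PGspace F r, has_pdim (r - 2) U ->
     #|section U S| = q ^ (r - 3) + 2 * q ^ (r - 4) ->
     is_hyperplane H -> (U <= H)%VS ->
     #|section H S| = q ^ (r - 2) + 2 * q ^ (r - 3)) /\
  (* (vii) *)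
  t = q ^ (r - 2) /\
  (* (viii) *)
  (forall (i : nat) (U W : PGspace F r), 1 <= i -> i <= r - 2 ->
     has_pdim (r - i) U ->
     #|section U S| = q ^ (r - i - 1) + 2 * q ^ (r - i - 2) ->
     has_pdim (r - i + 1) W -> (U <= W)%VS ->
     #|section W S| = q ^ (r - i) + 2 * q ^ (r - i - 1)).
Proof.
(* Writing r = n + 4 removes the truncated subtractions from the exponents. *)
subst q; case: r S hr ht1 ht2 hS hH => [|[|[|[|n]]]] // S _.
rewrite /is_hyperplane /is_line /is_plane /has_pdim !subSS !subn0 /=.
move=> t_gt t_le card_S hH.
have q_gt0 : 0 < #|F| by exact: leq_trans hq.
have t_lt : t < #|F| ^ n.+2 + #|F|.
  by rewrite -[ltnRHS]prednK ?addn_gt0 ?q_gt0 ?orbT // ltnS -subn1.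
have {hH} hyp (H : PGspace F n.+4) : \dim H = n.+4 ->
    [\/ #|section H S| = 0, #|section H S| = #|F| ^ n.+2 + 2 * #|F| ^ n.+1 |
        #|section H S| = #|F| ^ n.+2 + t] by move/eqP; exact: hH.
split=> [[|[|k]] U // _ k_lt /eqP dU|].
  have [/eqP|U_gt0] := posnP #|section U S|.
    by rewrite cards_eq0 => /eqP; left.
  right; rewrite !subSS !subn0.
  exact: (nonempty_section_ge hq t_gt t_lt card_S hyp k_lt dU U_gt0).
split=> [L /eqP dL|]; first exact: (line_section_neq1 hq t_gt t_lt card_S hyp).
split.
  split=> [[|[|k]] // _ k_le|].
    have [U dU sU] := exists_section_min hq t_gt t_lt card_S hyp k_le.
    by exists U; rewrite dU eqxx !subSS !subn0.
  have [L dL sL] := exists_secant_line hq t_gt t_lt card_S hyp.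
  by exists L; rewrite dL.
split=> [U /eqP dU sU|].
  exact: (oval_plane_hyperoval hq t_gt t_lt card_S hyp dU sU).
split; first exact: (even_q hq t_gt t_lt card_S hyp).
split=> [U H /eqP dU sU /eqP dH UH|].
  exact: (hyperplane_over_min hq t_gt t_lt card_S hyp dU sU dH UH).
split; first exact: (t_value hq t_gt t_lt card_S hyp).
move=> i U W i_gt0 i_le /eqP dU sU /eqP dW UW.
(* U has projective dimension [k.+2]; the case i = 1, with U a hyperplane, is [k = n.+1]. *)
have [k def_i] : exists k, n.+4 - i = k.+2 by exists (n.+2 - i); lia.
rewrite def_i in dU sU dW *; rewrite !subSS !subn0 in sU *.
rewrite addn1 in dW; have k_le : k <= n.+1 by lia.
exact: (section_over_min hq t_gt t_lt card_S hyp k_le dU sU dW UW).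
Qed.
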